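(* Let $(\Omega,\Sigma,\mu)$ be a measure space, $\rho:\Omega\to(0,\infty)$ measurable, $M>m>0$, and let $f,g,h\in L^2_\rho(\Omega)$ with $h(x)\neq 0$ for a.e. $x\in\Omega$, be such that the functions $$M\cdot\frac{g}{h}-\frac{f}{h},\qquad \frac{f}{h}-m\cdot\frac{g}{h}$$ are synchronous on $\Omega$. For $u,v\in L^2_\rho(\Omega)$ write $$\Gamma(u,v):=\det\begin{pmatrix}\int_\Omega\rho uv\,d\mu & \int_\Omega\rho uh\,d\mu\\ \int_\Omega\rho vh\,d\mu & \int_\Omega\rho h^2\,d\mu\end{pmatrix}.$$ Then $$0\le \Gamma(f,f)\,\Gamma(g,g)-\Gamma(f,g)^2\le \left(\frac14(M-m)^2\,\Gamma(g,g)-\Gamma(Mg-f,\,f-mg)\right)\Gamma(g,g)\ \left(\le\frac14(M-m)^2\,\Gamma(g,g)^2\right).$$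
   Context: $(\Omega,\Sigma,\mu)$ consists of a set $\Omega$, a $\sigma$-algebra $\Sigma$ of subsets of $\Omega$ and a countably additive positive measure $\mu$ on $\Sigma$ with values in $\mathbb{R}\cup\{\infty\}$. For measurable $\rho:\Omega\to(0,\infty)$, $L^2_\rho(\Omega)$ is the Hilbert space of real-valued measurable functions $f$ on $\Omega$ with $\int_\Omega\rho(s)|f(s)|^2\,d\mu(s)<\infty$. A pair of real-valued functions $(q,p)$ on $\Omega$ is synchronous if $(q(x)-q(y))(p(x)-p(y))\ge 0$ for a.e. $x,y\in\Omega$. *)

(* Defs.v *)
From HB Require Import structures.
From mathcomp Require Import all_boot all_order all_algebra.
From mathcomp Require Import all_classical all_reals all_analysis.

Set Implicit Arguments.
Unset Strict Implicit.
Unset Printing Implicit Defensive.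

Import Order.TTheory GRing.Theory Num.Theory.

Local Open Scope classical_set_scope.
Local Open Scope ring_scope.

Section Defs.
Context (d : measure_display) (T : measurableType d) (R : realType).
Variable mu : {measure set T -> \bar R}.
Implicit Types rho u v h p q : T -> R.

(* Elements of the weighted space L^2_rho are represented by functions rather
   than by classes modulo mu-a.e. equality. *)
Definition in_L2 rho u : Prop :=
  measurable_fun setT u /\
  (\int[mu]_x (rho x * `|u x| ^+ 2)%:E < +oo)%E.

Definition dotL2 rho u v : R := \int[mu]_x (rho x * u x * v x).

Definition Gamma rho h u v : R :=
  \det (\matrix_(i < 2, j < 2)
    if i == 0 then (if j == 0 then dotL2 rho u v else dotL2 rho u h)
    else (if j == 0 then dotL2 rho v h else dotL2 rho h h)).

(* "For a.e. x, y" is the iterated quantifier, which does not require mu to be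
   sigma-finite. When q and p are measurable and mu is sigma-finite, it amounts
   to "almost everywhere for the product measure of mu with itself". *)
Definition synchronous q p : Prop :=
  {ae mu, forall x, {ae mu, forall y, 0 <= (q x - q y) * (p x - p y)}}.

End Defs.

(* Main.v *)
(* With [w_y := h y * u - u y * h] and [z_y := h y * v - v y * h], one has
     2 * Gamma u v = \int_y rho y * dotL2 w_y z_y,
   a form of Chebyshev's sum identity in which only iterated single integrals
   occur, so that Fubini's theorem, hence sigma-finiteness, is not needed.
   The integrand is a.e. nonnegative when [u = v], and also when [u / h] and
   [v / h] are synchronous. Thus Gamma is a positive semidefinite bilinear form
   on L^2_rho, which gives Cauchy-Schwarz, and Gamma (M g - f) (f - m g) >= 0.
   The middle inequality is the algebraic identity
     rhs - lhs = (Gamma f g - (m + M) / 2 * Gamma g g) ^ 2. *)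
Require Import Defs.
From HB Require Import structures.
From mathcomp Require Import all_boot all_order all_algebra.
From mathcomp Require Import all_classical all_reals all_analysis.
From mathcomp Require Import measurable_realfun.
From mathcomp Require Import ring lra.

Import Order.TTheory GRing.Theory Num.Theory.

Local Open Scope classical_set_scope.
Local Open Scope ring_scope.

(** [k] agrees a.e. with its absolute value, so the two integrals coincide. *)
Lemma Rintegral_ae_ge0 {d : measure_display} {T : measurableType d}
    {R : realType} {mu : {measure set T -> \bar R}} (k : T -> R) :
  mu.-integrable setT (EFin \o k) -> {ae mu, forall x, 0 <= k x} ->
  0 <= \int[mu]_x k x.
Proof.
move=> /measurable_int mk k_ge0.
have -> : \int[mu]_x k x = \int[mu]_x `|k x|.
  congr fine; apply: ae_eq_integral => //.
    by apply/measurable_EFinP/measurableT_comp => //; exact/measurable_EFinP.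
  by apply: filterS k_ge0 => x kx _ /=; rewrite ger0_norm.
exact: Rintegral_ge0.
Qed.

Section WeightedL2.
Context {d : measure_display} {T : measurableType d} {R : realType}.
Context {mu : {measure set T -> \bar R}} {rho : T -> R}.
Context (rho_meas : measurable_fun setT rho) (rho_gt0 : forall x, 0 < rho x).
Implicit Types (u v w h : T -> R) (a b : R).

(** Puts membership in the product form of the integrand of [dotL2 mu rho u u], on which the
    integrability lemmas act. *)
Lemma in_L2P u : in_L2 mu rho u <->
  measurable_fun setT u /\
  mu.-integrable setT (EFin \o (fun x => rho x * u x * u x)).
Proof.
have E x : rho x * u x * u x = rho x * `|u x| ^+ 2.
  by rewrite real_normK ?num_real// expr2 mulrA.
have absE x : `|rho x * u x * u x| = rho x * `|u x| ^+ 2.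
  by rewrite E ger0_norm// mulr_ge0 ?sqr_ge0// ltW.
rewrite /in_L2; split=> -[mu_ iu]; split=> //.
  apply/integrableP; split.
    by apply/measurable_EFinP; do !apply: measurable_funM.
  by under eq_integral do rewrite /= absE.
case/integrableP : iu => _.
by under eq_integral do rewrite /= absE.
Qed.

Lemma integrable_dotL2 {u v} : in_L2 mu rho u -> in_L2 mu rho v ->
  mu.-integrable setT (EFin \o (fun x => rho x * u x * v x)).
Proof.
move=> /in_L2P[mu_ iu] /in_L2P[mv iv].
apply: le_integrable (integrableD measurableT iu iv) => //.
  by apply/measurable_EFinP; do !apply: measurable_funM.
move=> x _ /=; rewrite lee_fin.
have r0 := rho_gt0 x.
have sq0 : 0 <= rho x * u x * u x + rho x * v x * v x.
  by rewrite -!mulrA -mulrDr mulr_ge0 ?(ltW r0)// addr_ge0 // -expr2 sqr_ge0.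
rewrite (ger0_norm sq0) ler_norml.
(* The squares of [u + v] and [u - v] bound [rho * u * v] on both sides by half of the dominating
   function. *)
have := mulr_ge0 (ltW r0) (sqr_ge0 (u x + v x)).
have := mulr_ge0 (ltW r0) (sqr_ge0 (u x - v x)).
by move=> H1 H2; apply/andP; split; nra.
Qed.

Lemma integrable_lin {k l : T -> R} a b :
  mu.-integrable setT (EFin \o k) -> mu.-integrable setT (EFin \o l) ->
  mu.-integrable setT (EFin \o (fun x => a * k x + b * l x)).
Proof.
move=> ik il.
have ikl := integrableD measurableT (integrableZl measurableT a ik)
  (integrableZl measurableT b il).
exact: eq_integrable ikl.
Qed.

Lemma Rintegral_lin {k l : T -> R} a b :
  mu.-integrable setT (EFin \o k) -> mu.-integrable setT (EFin \o l) ->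
  \int[mu]_x (a * k x + b * l x) = a * \int[mu]_x k x + b * \int[mu]_x l x.
Proof.
move=> ik il; rewrite RintegralD ?RintegralZl//.
  by apply: eq_integrable (integrableZl measurableT a ik).
by apply: eq_integrable (integrableZl measurableT b il).
Qed.

Lemma in_L2_lin {u v} a b : in_L2 mu rho u -> in_L2 mu rho v ->
  in_L2 mu rho (fun x => a * u x + b * v x).
Proof.
move=> uL2 vL2; apply/in_L2P; split.
  case: uL2 vL2 => [mu_ _] [mv _].
  by apply: measurable_funD; apply: measurable_funM.
(* Expanding the square leaves a combination of the integrable products [u * u], [u * v] and
   [v * v], weighted by [rho]. *)
have i1 := integrable_lin (a ^+ 2) (a * b *+ 2)
  (integrable_dotL2 uL2 uL2) (integrable_dotL2 uL2 vL2).
have i2 := integrable_lin 1 (b ^+ 2) i1 (integrable_dotL2 vL2 vL2).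
by apply: eq_integrable i2 => // x _ /=; congr EFin; ring.
Qed.

Lemma dotL2C u v : dotL2 mu rho u v = dotL2 mu rho v u.
Proof. by apply: eq_Rintegral => x _; rewrite mulrAC. Qed.

Lemma dotL2_linr {u v w} a b :
  in_L2 mu rho u -> in_L2 mu rho v -> in_L2 mu rho w ->
  dotL2 mu rho w (fun x => a * u x + b * v x) =
  a * dotL2 mu rho w u + b * dotL2 mu rho w v.
Proof.
move=> uL2 vL2 wL2; rewrite /dotL2.
rewrite -(Rintegral_lin a b (integrable_dotL2 wL2 uL2) (integrable_dotL2 wL2 vL2)).
by apply: eq_Rintegral => x _; ring.
Qed.

Lemma GammaE h u v : Gamma mu rho h u v =
  dotL2 mu rho u v * dotL2 mu rho h h - dotL2 mu rho u h * dotL2 mu rho v h.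
Proof.
rewrite /Gamma (expand_det_row _ ord0) !big_ord_recl big_ord0 /cofactor.
rewrite !det_mx11 !mxE /=; ring.
Qed.

Lemma GammaC h u v : Gamma mu rho h u v = Gamma mu rho h v u.
Proof. by rewrite !GammaE (dotL2C u v) [in LHS]mulrC; ring. Qed.

Lemma Gamma_linr {h u v w} a b : in_L2 mu rho h ->
  in_L2 mu rho u -> in_L2 mu rho v -> in_L2 mu rho w ->
  Gamma mu rho h w (fun x => a * u x + b * v x) =
  a * Gamma mu rho h w u + b * Gamma mu rho h w v.
Proof.
move=> hL2 uL2 vL2 wL2.
rewrite !GammaE dotL2_linr// (dotL2C (fun x => a * u x + b * v x)) dotL2_linr//.
by rewrite (dotL2C h u) (dotL2C h v); ring.
Qed.

Lemma Gamma_linl {h u v w} a b : in_L2 mu rho h ->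
  in_L2 mu rho u -> in_L2 mu rho v -> in_L2 mu rho w ->
  Gamma mu rho h (fun x => a * u x + b * v x) w =
  a * Gamma mu rho h u w + b * Gamma mu rho h v w.
Proof. by move=> *; rewrite GammaC Gamma_linr// !(GammaC h w). Qed.

Lemma Gamma_ge0 h u v :
  in_L2 mu rho h -> in_L2 mu rho u -> in_L2 mu rho v ->
  {ae mu, forall y, {ae mu, forall x,
    0 <= (h y * u x - u y * h x) * (h y * v x - v y * h x)}} ->
  0 <= Gamma mu rho h u v.
Proof.
move=> hL2 uL2 vL2 uv_ge0.
pose D := dotL2 mu rho.
pose W y := fun x => h y * u x + - u y * h x.
pose Z y := fun x => h y * v x + - v y * h x.
have WL2 y : in_L2 mu rho (W y) by exact: in_L2_lin.
have ZL2 y : in_L2 mu rho (Z y) by exact: in_L2_lin.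
have WZE y : D (W y) (Z y) = h y * h y * D u v - h y * v y * D u h
    - u y * h y * D v h + u y * v y * D h h.
  rewrite /D dotL2_linr// !(dotL2C (W y)) !dotL2_linr//.
  by rewrite (dotL2C v u) (dotL2C h u); ring.
(* The terms of [D (W y) (Z y)] are grouped by their factor [h y] or [u y]. The cofactors [P] and
   [Q] lie in the weighted space, so the outer integrand is a sum of two integrable products. *)
pose P := fun y => D u v * h y + - D u h * v y.
pose Q := fun y => D h h * v y + - D v h * h y.
have PL2 : in_L2 mu rho P by exact: in_L2_lin.
have QL2 : in_L2 mu rho Q by exact: in_L2_lin.
have hP := integrable_dotL2 hL2 PL2.
have uQ := integrable_dotL2 uL2 QL2.
have PQE y : rho y * h y * P y + rho y * u y * Q y = rho y * D (W y) (Z y).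
  by rewrite WZE /P /Q; ring.
have -> : Gamma mu rho h u v =
    2^-1 * \int[mu]_y (rho y * h y * P y + rho y * u y * Q y).
  (* Each of [D h P] and [D u Q] equals [Gamma u v], whence the factor one half. *)
  rewrite RintegralD// -!/(dotL2 _ _ _ _) !dotL2_linr// GammaE.
  by rewrite /D (dotL2C h v); field.
rewrite mulr_ge0 ?invr_ge0//; apply: Rintegral_ae_ge0.
  by apply: eq_integrable (integrableD measurableT hP uQ).
apply: filterS uv_ge0 => y uv_ge0; rewrite PQE mulr_ge0 ?(ltW (rho_gt0 _))//.
apply: Rintegral_ae_ge0; first exact: integrable_dotL2.
apply: filterS uv_ge0 => x uv_ge0.
by rewrite -mulrA mulr_ge0 ?(ltW (rho_gt0 _))// /W /Z !mulNr.
Qed.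

Lemma Gamma_diag_ge0 h u : in_L2 mu rho h -> in_L2 mu rho u ->
  0 <= Gamma mu rho h u u.
Proof.
move=> hL2 uL2; apply: Gamma_ge0 => //.
by apply: aeW => y; apply: aeW => x; rewrite -expr2 sqr_ge0.
Qed.

Lemma Gamma_CauchySchwarz h u v :
  in_L2 mu rho h -> in_L2 mu rho u -> in_L2 mu rho v ->
  Gamma mu rho h u v ^+ 2 <= Gamma mu rho h u u * Gamma mu rho h v v.
Proof.
move=> hL2 uL2 vL2; set G := Gamma mu rho h.
have quad a b : 0 <= a ^+ 2 * G u u + a * b * G u v *+ 2 + b ^+ 2 * G v v.
  have := Gamma_diag_ge0 h _ hL2 (in_L2_lin a b uL2 vL2).
  rewrite Gamma_linr//; last exact: in_L2_lin.
  rewrite !Gamma_linl// (GammaC h v u) -/G.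
  by congr (_ <= _); ring.
have [Gv0|] := eqVneq (G v v) 0.
  have Guu := Gamma_diag_ge0 h _ hL2 uL2; rewrite -/G in Guu.
  (* Here the form takes the value [- (G u u + 2) * G u v ^+ 2], which is nonnegative only if
     [G u v = 0]. *)
  have := quad (G u v) (- (G u u + 1)); rewrite Gv0 => q.
  have := sqr_ge0 (G u v); nra.
have := Gamma_diag_ge0 h _ hL2 vL2; rewrite le0r -/G => /orP[/eqP-> /eqP//|Gv _].
rewrite -subr_ge0 -(pmulr_rge0 _ Gv).
(* At this point the form is [G v v] times the difference [G u u * G v v - G u v ^+ 2]. *)
have := quad (G v v) (- G u v).
by congr (_ <= _); ring.
Qed.

End WeightedL2.

Theorem proposition2 (d : measure_display) (T : measurableType d)
    (R : realType) (mu : {measure set T -> \bar R}) (rho : T -> R)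
    (m M : R) (f g h : T -> R)
    (rho_meas : measurable_fun setT rho) (rho_gt0 : forall x, 0 < rho x)
    (m_gt0 : 0 < m) (ltmM : m < M)
    (fL2 : in_L2 mu rho f) (gL2 : in_L2 mu rho g) (hL2 : in_L2 mu rho h)
    (h_neq0 : {ae mu, forall x, h x <> 0})
    (sync : synchronous mu (fun x => M * (g x / h x) - f x / h x)
                           (fun x => f x / h x - m * (g x / h x))) :
  let G := Gamma mu rho h in
  let K := G (fun x => M * g x - f x) (fun x => f x - m * g x) in
  [/\ 0 <= G f f * G g g - G f g ^+ 2,
      G f f * G g g - G f g ^+ 2
        <= (4^-1 * (M - m) ^+ 2 * G g g - K) * G g g
    & (4^-1 * (M - m) ^+ 2 * G g g - K) * G g g
        <= 4^-1 * (M - m) ^+ 2 * G g g ^+ 2].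
Proof.
move=> G K.
have Ggg_ge0 : 0 <= G g g by exact: Gamma_diag_ge0.
have CS : G f g ^+ 2 <= G f f * G g g by exact: Gamma_CauchySchwarz.
(* Both functions are put in the shape [a * u x + b * v x] expected by the linearity lemmas. *)
have uE : (fun x => M * g x - f x) = (fun x => M * g x + -1 * f x).
  by apply/funext => x; rewrite mulN1r.
have vE : (fun x => f x - m * g x) = (fun x => 1 * f x + - m * g x).
  by apply/funext => x; rewrite mul1r mulNr.
have uL2 : in_L2 mu rho (fun x => M * g x - f x) by rewrite uE; exact: in_L2_lin.
have vL2 : in_L2 mu rho (fun x => f x - m * g x) by rewrite vE; exact: in_L2_lin.
have K_ge0 : 0 <= K.
  apply: Gamma_ge0 => //.
  apply: filterS2 (h_neq0) sync => y hy sync_y.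
  apply: filterS2 (h_neq0) sync_y => x hx sync_xy.
  (* Multiplying by this square clears the denominators in the synchronicity inequality; swapping
     [x] and [y] changes the sign of both factors, hence not their product. *)
  have hxy : 0 <= (h x * h y) ^+ 2 by exact: sqr_ge0.
  have := mulr_ge0 hxy sync_xy.
  congr (_ <= _); field.
  by apply/andP; split; apply/eqP.
have KE : K = (m + M) * G f g - m * M * G g g - G f f.
  rewrite /K /G uE vE Gamma_linr// -?uE// uE !Gamma_linl//.
  by rewrite (GammaC h g f); ring.
split; first by rewrite subr_ge0.
  (* The terms in [G f f] cancel, and the square is completed by [(M - m) ^+ 2 / 4 + m * M = (m + M)
     ^+ 2 / 4]. *)
  rewrite -subr_ge0 KE.
  have := sqr_ge0 (G f g - 2^-1 * (m + M) * G g g).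
  by congr (_ <= _); field.
(* The difference of the two sides is [K * G g g]. *)
rewrite -subr_ge0.
have := mulr_ge0 K_ge0 Ggg_ge0.
by congr (_ <= _); ring.
Qed.
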